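(* Let $v>0$ and let $\psi:\mathbb{R}\to[0,1]$ be a continuous monotonically decreasing function with $\lim_{x\to-\infty}\psi(x)=1$ and $\lim_{x\to\infty}\psi(x)=0$. Let $u(x,t)=\psi(x-vt)$, $x\in\mathbb{R}$, $t\ge 0$, be the traveling wave with constant speed $v$ and profile $\psi$, with the two-sided estimate $$u_\varepsilon^-(x,t)\le u(x,t)\le u_\varepsilon^+(x,t)\qquad\text{for all }x\in\mathbb{R},\ t\ge 0,\ \varepsilon>0,$$ where $u_\varepsilon^{\pm}$ are the upper and lower waves defined in the context. Let $S$ be a driftless subordinator with Lévy measure $\sigma$ satisfying $\sigma((0,\infty))=\infty$, let $k(t)=\sigma((t,\infty))$, let $\mathcal{K}$ be the Laplace transform of $k$, and let $G_t(\tau)$ be the probability density of $E(t)$, where $E$ is the inverse process of $S$. Assume that, for some constant $\mu(0)>0$, $$\mathcal{K}(\lambda)\sim\lambda^{-1}\,\mu(0)\,\bigl(\log(1/\lambda)\bigr)^{-1}\qquad\text{as }\lambda\to 0^+ .$$ Let $u^E(x,t)=\int_0^\infty u(x,\tau)G_t(\tau)\,\mathrm{d}\tau$ be the subordination of $u$ by $G_t$, and let $M_t(u^E(x,\cdot))=\frac1t\int_0^t u^E(x,s)\,\mathrm{d}s$ be its Cesàro mean. For $\beta\in(0,1)$ and $t>0$ let $x_\beta(t)\in\mathbb{R}$ be the propagation of the front of level $\beta$ of the Cesàro mean, i.e. the solution of $M_t(u^E(x_\beta(t),\cdot))=\beta$. Then for every $\beta\in(0,1)$ there are constants $C_-,C_+>0$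 such that $$C_-\log(t)\le x_\beta(t)\le C_+\log(t)\qquad\text{for all sufficiently large }t,$$ and moreover there is a constant $C>0$ such that $x_\beta(t)\sim C\log(t)$ as $t\to\infty$.
   Context: Asymptotic equivalence: $f\sim g$ means that $f/g\to 1$ in the indicated limit. Subordinator: $S=\{S(t),t\ge0\}$ is a process starting from $0$ with stationary and independent non-negative increments and no drift, with $\mathbb{E}(e^{-\lambda S(t)})=e^{-t\Phi(\lambda)}$ for $\lambda\ge0$, where $\Phi(\lambda)=\int_{(0,\infty)}(1-e^{-\lambda\tau})\,\mathrm{d}\sigma(\tau)$ and the Lévy measure $\sigma$ satisfies $\int_{(0,\infty)}(1\wedge\tau)\,\mathrm{d}\sigma(\tau)<\infty$ and $\sigma((0,\infty))=\infty$. Put $k(t)=\sigma((t,\infty))$ for $t>0$ and $\mathcal{K}(\lambda)=\int_0^\infty e^{-\lambda t}k(t)\,\mathrm{d}t$; then $\Phi(\lambda)=\lambda\mathcal{K}(\lambda)$ for $\lambda>0$. The inverse process is $E(t)=\inf\{s\ge0: S(s)\ge t\}$, and $G_t(\tau)$, $\tau\ge0$, is the density of the law of $E(t)$, so that $P(E(t)\le\tau)=P(S(\tau)\ge t)$. Upper and lower waves: for each $\varepsilon>0$ choose $x_\varepsilon^-,x_\varepsilon^+\in\mathbb{R}$ such that $\psi(y)<\varepsilon$ for all $y>x_\varepsilon^+$ and $\psi(y)>1-\varepsilon$ for all $y<x_\varepsilon^-$, and set $u_\varepsilon^+(x,t)=\mathbf{1}_{(-\infty,x_\varepsilon^+]}(x-vt)+\varepsilon\,\mathbf{1}_{[x_\varepsilon^+,\infty)}(x-vt)$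 and $u_\varepsilon^-(x,t)=(1-\varepsilon)\,\mathbf{1}_{(-\infty,x_\varepsilon^-]}(x-vt)$. *)

(* Defs.v *)
From HB Require Import structures.
From mathcomp Require Import all_boot all_order all_algebra.
From mathcomp Require Import all_classical all_reals all_analysis.
From mathcomp Require Import measurable_realfun.
Import Order.TTheory GRing.Theory Num.Theory.
Import numFieldNormedType.Exports.

Set Implicit Arguments.
Unset Strict Implicit.
Unset Printing Implicit Defensive.

Local Open Scope classical_set_scope.
Local Open Scope ring_scope.

Definition asymp_equiv (R : realType) (F : set_system R) (f g : R -> R) : Prop :=
  f x / g x @[x --> F] --> (1 : R).

(* Subfamilies are covered by taking [B i = setT] outside of them. *)
Definition mutually_independent (d : measure_display) (T : measurableType d)
    (R : realType) (P : probability T R) (n : nat) (X : 'I_n -> T -> R) : Prop :=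
  forall B : 'I_n -> set R, (forall i, measurable (B i)) ->
    P (\bigcap_(i in [set: 'I_n]) (X i @^-1` B i)) =
    (\prod_(i < n) P (X i @^-1` B i))%E.

(* Measures on (0, oo) are represented by measures on R, of which only the
   restriction to (0, oo) is ever used. *)
Record levy_measure (R : realType) (sigma : {measure set R -> \bar R}) : Prop := {
  levy_integrable :
    (\int[sigma]_(tau in `]0%R, +oo[) (Num.min 1 tau)%:E < +oo)%E ;
  levy_infinite : sigma `]0, +oo[%classic = +oo%E }.

Definition laplace_exponent (R : realType) (sigma : {measure set R -> \bar R})
    (lambda : R) : R :=
  \int[sigma]_(tau in `]0, +oo[) (1 - expR (- (lambda * tau))).

(* Absence of drift is expressed by the form of the Laplace exponent. *)
Record subordinator (d : measure_display) (T : measurableType d)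
    (R : realType) (P : probability T R) (sigma : {measure set R -> \bar R})
    (S : R -> {RV P >-> R}) : Prop := {
  subordinator_start : forall omega, S 0 omega = 0 ;
  subordinator_increments_ge0 : forall (s t : R) omega, 0 <= s -> s <= t ->
    0 <= S t omega - S s omega ;
  subordinator_stationary : forall (s h : R) (B : set R), 0 <= s -> 0 <= h ->
    measurable B ->
    P ((fun omega => S (s + h) omega - S s omega) @^-1` B) =
    P ((fun omega => S h omega - S 0 omega) @^-1` B) ;
  subordinator_independent : forall (n : nat) (t : nat -> R), 0 <= t 0%N ->
    (forall i, t i <= t i.+1) ->
    mutually_independent P
      (fun (i : 'I_n) omega => S (t i.+1) omega - S (t i) omega) ;
  subordinator_laplace : forall t lambda : R, 0 <= t -> 0 <= lambda ->
    'E_P[fun omega => expR (- (lambda * S t omega))]%E =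
    (expR (- (t * laplace_exponent sigma lambda)))%:E }.

(* [k t] is finite for [t > 0] when [sigma] is a Levy measure. *)
Definition levy_tail (R : realType) (sigma : {measure set R -> \bar R})
    (t : R) : R := fine (sigma `]t, +oo[%classic).

Definition laplace_transform (R : realType) (f : R -> R) (lambda : R) : R :=
  \int[lebesgue_measure]_(t in `]0, +oo[) (expR (- (lambda * t)) * f t).

(* Extended-real valued, so that the infimum of the empty set is +oo. *)
Definition inverse_process (T : Type) (R : realType) (S : R -> T -> R)
    (t : R) (omega : T) : \bar R :=
  ereal_inf [set s%:E | s in [set s : R | 0 <= s /\ t <= S s omega]].

(* Taking [B = [set +oo]] shows that [X] is almost surely finite, and
   [B = setT] that [g] has total mass one. *)
Record is_law_density (d : measure_display) (T : measurableType d)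
    (R : realType) (P : probability T R) (X : T -> \bar R) (g : R -> R)
    : Prop := {
  density_measurable : measurable_fun (`[0, +oo[%classic : set R) g ;
  density_ge0 : forall tau : R, 0 <= tau -> 0 <= g tau ;
  density_law : forall B : set (\bar R), measurable B ->
    P (X @^-1` B) =
    (\int[lebesgue_measure]_(tau in [set tau : R | (0 <= tau)%R /\ B tau%:E])
       (g tau)%:E)%E }.

Definition traveling_wave (R : realType) (psi : R -> R) (v x t : R) : R :=
  psi (x - v * t).

Definition upper_wave (R : realType) (v : R) (xp : R -> R) (eps x t : R) : R :=
  \1_`]-oo, xp eps]%classic (x - v * t) +
  eps * \1_`[xp eps, +oo[%classic (x - v * t).

Definition lower_wave (R : realType) (v : R) (xm : R -> R) (eps x t : R) : R :=
  (1 - eps) * \1_`]-oo, xm eps]%classic (x - v * t).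

Definition subordination (R : realType) (G : R -> R -> R) (u : R -> R -> R)
    (x t : R) : R :=
  \int[lebesgue_measure]_(tau in `[0, +oo[) (u x tau * G t tau).

Definition cesaro_mean (R : realType) (f : R -> R) (t : R) : R :=
  t^-1 * \int[lebesgue_measure]_(s in `[0, t]) f s.

(* Main.v *)
Require Import Defs.
From HB Require Import structures.
From mathcomp Require Import all_boot all_order all_algebra.
From mathcomp Require Import all_classical all_reals all_analysis.
From mathcomp Require Import measurable_realfun ring lra.
Import Order.TTheory GRing.Theory Num.Theory.
Import numFieldNormedType.Exports.

Local Open Scope classical_set_scope.
Local Open Scope ring_scope.

(** By Tonelli, [Phi lambda = lambda * K lambda], so the hypothesis says that
    [Phi (L / t) * ln t --> mu0] for every [L > 0].  Two Chernoff bounds,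
    [e^(- tau Phi lambda) - e^(- lambda t) <= P (S tau < t)
       <= e^(lambda t - tau Phi lambda)],
    with [lambda = L / t] and [tau = c ln t], then give
    [P (E t >= c ln t) --> e^(- c mu0)]: [E t / ln t] is asymptotically
    exponential.  Since the wave at [x] is close to [1] or to [0] according to
    whether [v * E t] exceeds [x] or not, and since [ln] is slowly varying, the
    Cesaro mean at [x = y ln t] tends to [e^(- y mu0 / v)], whence
    [x_beta t / ln t --> v ln (1 / beta) / mu0]. *)

(** * Integrals and Cesàro means without measurability in time *)

Section nonneg_integral.
Local Open Scope ereal_scope.
Import HBNNSimple.

(* The integral of a nonnegative function is a supremum over the simple functions
   below it, so monotonicity needs no measurability. This dispenses with
   proving that the subordinated wave is measurable in time. *)
Lemma ge0_le_integral_nonmeasurable (d : measure_display)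
    (T : measurableType d) (R : realType) (mu : {measure set T -> \bar R})
    (D : set T) (f g : T -> \bar R) :
  (forall x, D x -> 0 <= f x) -> (forall x, D x -> f x <= g x) ->
  \int[mu]_(x in D) f x <= \int[mu]_(x in D) g x.
Proof.
move=> f0 fg; have g0 x : D x -> 0 <= g x.
  by move=> Dx; exact: le_trans (f0 _ Dx) (fg _ Dx).
rewrite !ge0_integralE//; apply: ereal_sup_le => _ [h hf <-].
exists h => // x; apply: le_trans (hf x) _.
by rewrite /patch; case: ifPn => //; rewrite inE => /fg.
Qed.

End nonneg_integral.

Local Notation mu := lebesgue_measure.

(* [f 0] is arbitrary, possibly negative: the density [G 0] of the definition of
   the subordination at time [0] is unspecified. *)
Lemma integral_itv0_bounded (R : realType) (f : R -> R) (t A : R) : 0 < t ->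
  (forall s, 0 < s <= t -> 0 <= f s <= A) ->
  exists2 I : R, (\int[lebesgue_measure]_(s in `[0%R, t]) (f s)%:E = I%:E)%E &
    0 <= I <= A * t /\
    forall delta B, 0 <= delta <= 1 -> 0 <= B ->
      (forall s, delta * t <= s <= t -> 0 < s -> B <= f s) ->
      B * ((1 - delta) * t) <= I.
Proof.
move=> t0 fA.
have A0 : 0 <= A.
  by have /fA/andP[f0 fA'] : 0 < t <= t by [rewrite t0 lexx]; exact: le_trans fA'.
have c0 : 0 <= `|f 0| by [].
have mut : mu `[0%R, t]%classic = t%:E.
  by rewrite lebesgue_measure_itv/= lte_fin t0 oppr0 adde0.
have mu0 : mu ([set (0%R : R)] `&` `[0, t]%classic) = 0%E.
  rewrite setIidl ?lebesgue_measure_set1// => x ->.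
  by rewrite /= in_itv/= lexx ltW.
(* A multiple of the indicator of [{0}] has zero integral. With the factor [|f 0|] it dominates the
   negative part of [f], and added to [A] it dominates the positive part, so the value at [0] is
   harmless. *)
have ind0 (B : R) : (0 <= B)%R ->
  (\int[mu]_(s in `[0%R, t]) (B * \1_[set 0] s)%:E = 0)%E.
  move=> B0; under eq_integral do rewrite EFinM.
  rewrite ge0_integralZl//=; last first.
    by apply/measurable_EFinP; exact: measurable_indic.
  rewrite integral_indic//; transitivity (B%:E * 0)%E; last exact: mule0.
  by congr (_ * _)%E; exact: mu0.
rewrite integralE.
have -> : (\int[mu]_(s in `[0%R, t]) (fun s => (f s)%:E)^\- s = 0)%E.
  apply/eqP; rewrite eq_le integral_ge0 ?andbT//.
  rewrite -(ind0 _ c0); apply: ge0_le_integral_nonmeasurable => // s.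
  rewrite /= in_itv/= funenegE => /andP[s0 st].
  rewrite -EFinN -EFin_max lee_fin ge_max mulr_ge0// andbT indicE.
  have [->|sn0] := eqVneq s 0; first by rewrite mem_set// mulr1 ler_normr lexx orbT.
  have /fA/andP[fs0 _] : 0 < s <= t by rewrite lt_def sn0 s0.
  by rewrite (le_trans (_ : _ <= 0)) ?oppr_le0 ?mulr_ge0.
rewrite sube0.
set J := integral _ _ _.
have J0 : (0 <= J)%E by apply: integral_ge0.
have JA : (J <= (A * t)%:E)%E.
  have -> : ((A * t)%:E =
    \int[mu]_(s in `[0%R, t]) (A%:E + (`|f 0| * \1_[set 0] s)%:E))%E.
    rewrite ge0_integralD//=.
    - rewrite ind0// adde0 integral_cst//; rewrite EFinM; congr (_ * _)%E; exact/esym.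
    - apply/measurable_EFinP/measurable_funM; first exact: measurable_cst.
      exact: measurable_indic.
  apply: ge0_le_integral_nonmeasurable => // s.
  rewrite /= in_itv/= funeposE => /andP[s0 st].
  rewrite -EFin_max -EFinD lee_fin ge_max addr_ge0 ?mulr_ge0// andbT indicE.
  have [->|sn0] := eqVneq s 0.
    by rewrite mem_set// mulr1 (le_trans (ler_norm _))// lerDr.
  have /fA/andP[fs0 fsA] : 0 < s <= t by rewrite lt_def sn0 s0.
  by rewrite (le_trans fsA)// lerDl mulr_ge0.
have Jfin : J \is a fin_num by rewrite ge0_fin_numE// (le_lt_trans JA) ?ltry.
exists (fine J); first by rewrite fineK.
split; first by rewrite -!lee_fin fineK// J0 JA.
move=> delta B /andP[d0 d1] B0 fB.
rewrite -lee_fin fineK//.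
apply: (@le_trans _ _
  (\int[mu]_(s in `[0%R, t]) (B * \1_(`](delta * t), t]%classic) s)%:E)%E).
  under eq_integral do rewrite EFinM.
  rewrite ge0_integralZl//=; last first.
    by apply/measurable_EFinP; exact: measurable_indic.
  rewrite integral_indic// EFinM lee_wpmul2l ?lee_fin//.
  have -> : `](delta * t), t]%classic `&` `[0, t]%classic = `](delta * t), t]%classic.
    apply/setIidPl => s /=; rewrite !in_itv/= => /andP[ds ->]; rewrite andbT.
    by rewrite (le_trans _ (ltW ds))// mulr_ge0// ltW.
  suff h : mu `](delta * t), t]%classic = ((1 - delta) * t)%:E.
    by rewrite le_eqVlt; apply/orP; left; apply/eqP; exact/esym.
  rewrite lebesgue_measure_itv/= lte_fin mulrBl mul1r.
  case: ifPn => [_|]; first by rewrite -EFinB.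
  rewrite -leNgt => h; congr EFin; apply/eqP; rewrite eq_sym subr_eq0 eq_le h.
  by rewrite ler_piMl// ltW.
apply: ge0_le_integral_nonmeasurable => s /=; rewrite in_itv/= => /andP[s0 st].
  by rewrite lee_fin mulr_ge0.
rewrite funeposE -EFin_max lee_fin le_max indicE.
have [ds|sd] := ltP (delta * t) s.
  rewrite mem_set ?mulr1 ?fB// ?(ltW ds)//; last by rewrite /= in_itv/= ds.
  by rewrite (le_lt_trans _ ds)// mulr_ge0// ltW.
rewrite memNset ?mulr0 ?lexx ?orbT//= in_itv/= => /andP[+ _].
by rewrite ltNge sd.
Qed.

Lemma cesaro_mean_le (R : realType) (f : R -> R) (t A : R) : 0 < t ->
  (forall s, 0 < s <= t -> 0 <= f s <= A) -> cesaro_mean f t <= A.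
Proof.
move=> t0 fA; have [I fI [/andP[_ IA] _]] := integral_itv0_bounded _ _ _ _ t0 fA.
by rewrite /cesaro_mean /Rintegral fI/= mulrC ler_pdivrMr.
Qed.

(** The times before [delta * t] contribute at least [0], which leaves an interval of length
    [(1 - delta) * t]; this suits lower bounds that degenerate as [s] tends to [0]. The upper bound
    [A] makes the integral finite, so that [fine] preserves it. *)
Lemma cesaro_mean_ge (R : realType) (f : R -> R) (t A B delta : R) : 0 < t ->
  (forall s, 0 < s <= t -> 0 <= f s <= A) -> 0 <= delta <= 1 -> 0 <= B ->
  (forall s, delta * t <= s <= t -> 0 < s -> B <= f s) ->
  B * (1 - delta) <= cesaro_mean f t.
Proof.
move=> t0 fA d01 B0 fB.
have [I fI [_ /(_ _ _ d01 B0 fB) BI]] := integral_itv0_bounded _ _ _ _ t0 fA.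
by rewrite /cesaro_mean /Rintegral fI/= [t^-1 * _]mulrC ler_pdivlMr// -mulrA.
Qed.

(** * Chernoff bounds from the Laplace transform of a random variable *)

Section chernoff.
Context (d : measure_display) (T : measurableType d) (R : realType)
  (P : probability T R) (X : {RV P >-> R}) (lambda r : R).
Hypotheses (lambda_ge0 : 0 <= lambda)
  (laplaceX : 'E_P[fun omega => expR (- (lambda * X omega))]%E = r%:E).

Lemma measurable_RV_lt (t : R) : measurable [set omega | (X omega < t)%R].
Proof.
have := measurable_funPTI X
  (measurable_itv `]-oo, t[ : measurable (`]-oo, t[%classic : set R)).
by congr (measurable _); apply/seteqP; split => omega /=; rewrite in_itv.
Qed.

Let measurable_laplaceX :
  measurable_fun setT (fun omega => (expR (- (lambda * X omega)))%:E).
Proof.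
apply/measurable_EFinP; apply: measurableT_comp => //.
by apply: measurable_funN; apply: measurable_funM.
Qed.

(** Markov's inequality: [e^(lambda (t - X))] is at least [1] on [X < t] and nonnegative
    elsewhere. *)
Lemma laplace_tail_le (t : R) :
  (P [set omega | (X omega < t)%R] <= (expR (lambda * t) * r)%:E)%E.
Proof.
rewrite EFinM -laplaceX unlock -ge0_integralZl//=.
rewrite -[[set omega | (X omega < t)%R]]setIT -integral_indic//; last first.
  exact: measurable_RV_lt.
apply: ge0_le_integral_nonmeasurable => omega _; first by rewrite lee_fin.
rewrite -EFinM lee_fin indicE.
have [Xt|Xt] := boolP (omega \in _); last by rewrite mulr_ge0 ?expR_ge0.
move: Xt; rewrite inE/= => Xt.
by rewrite -expRD -expR0 ler_expR -mulrBr mulr_ge0// subr_ge0 ltW.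
Qed.

(** Take expectations in [e^(- lambda X) <= 1_(X < t) + e^(- lambda t)]: where [X < t] the left side
    is at most [1] because [X >= 0], and elsewhere it is at most [e^(- lambda t)]. *)
Lemma laplace_tail_ge (t : R) : (forall omega, 0 <= X omega) ->
  ((r - expR (- (lambda * t)))%:E <= P [set omega | (X omega < t)%R])%E.
Proof.
move=> X0; rewrite EFinB leeBlDr// -laplaceX unlock.
rewrite -[[set omega | (X omega < t)%R]]setIT -integral_indic//; last first.
  exact: measurable_RV_lt.
have -> : (expR (- (lambda * t)))%:E = (\int[P]_omega (expR (- (lambda * t)))%:E)%E.
  by rewrite integral_cst//= probability_setT mule1.
rewrite -ge0_integralD//=; last first.
  by apply/measurable_EFinP/measurable_indic/measurable_RV_lt.
apply: ge0_le_integral_nonmeasurable => omega _; first by rewrite lee_fin expR_ge0.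
rewrite -EFinD lee_fin indicE.
have [Xt|tX] := ltP (X omega) t.
  rewrite mem_set// (@le_trans _ _ 1) ?lerDl ?expR_ge0//.
  by rewrite -expR0 ler_expR oppr_le0 mulr_ge0.
rewrite memNset ?add0r ?ler_expR ?lerN2 ?ler_wpM2l//=.
by apply/negP; rewrite -leNgt.
Qed.

End chernoff.

(** * Pathwise comparison of a nondecreasing process with its inverse *)

Section inverse_process.
Context (T : Type) (R : realType) (S : R -> T -> R) (omega : T).
Hypothesis S_nd : forall s t, 0 <= s -> s <= t -> S s omega <= S t omega.

Lemma inverse_process_ge (t a : R) : 0 <= a -> S a omega < t ->
  (a%:E <= inverse_process S t omega)%E.
Proof.
move=> a0 Sa; apply/le_ereal_inf_tmp => _ [s [s0 ts] <-].
rewrite lee_fin leNgt; apply/negP => sa.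
by have := lt_le_trans Sa (le_trans ts (S_nd _ _ s0 (ltW sa))); rewrite ltxx.
Qed.

(** The strict gap [a' < a] matters: if the path jumps over [t] exactly at [a], then [E t = a]
    although [S a >= t]. *)
Lemma inverse_process_lt (t a a' : R) : 0 <= a' -> a' < a ->
  (a%:E <= inverse_process S t omega)%E -> S a' omega < t.
Proof.
move=> a'0 a'a aE; rewrite ltNge; apply/negP => tS.
have : (inverse_process S t omega <= a'%:E)%E.
  by apply: ereal_inf_lbound; exists a'.
by move=> /(le_trans aE); rewrite lee_fin leNgt a'a.
Qed.

End inverse_process.

(** * The identity [Phi lambda = lambda * K lambda] *)

Section laplace_exponent.
Context (R : realType) (sigma : {measure set R -> \bar R}).
Context (sigma_levy : levy_measure sigma).

Local Notation pos := (`]0%R, +oo[%classic : set R).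

(** On [(t, oo)] the integrable function [min 1 tau] is at least the positive constant [min 1 t]. *)
Lemma levy_tail_lty (t : R) : 0 < t -> (sigma `]t, +oo[%classic < +oo)%E.
Proof.
move=> t0; set m := Num.min 1 t.
have m0 : 0 < m by rewrite lt_min ltr01.
have : (m%:E * sigma `]t, +oo[%classic < +oo)%E.
  apply: le_lt_trans (levy_integrable sigma_levy).
  have -> : sigma `]t, +oo[%classic =
      (\int[sigma]_(tau in pos) (\1_(`]t, +oo[%classic) tau)%:E)%E.
    rewrite integral_indic// setIidl// => x /=; rewrite !in_itv/= !andbT.
    exact: lt_trans.
  rewrite -ge0_integralZl//=; last 2 first.
    by apply/measurable_EFinP; exact: measurable_indic.
    by rewrite lee_fin ltW.
  apply: ge0_le_integral_nonmeasurable => tau /=; rewrite in_itv/= andbT => tau0.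
    by rewrite -EFinM lee_fin mulr_ge0// ltW.
  rewrite -EFinM lee_fin indicE.
  have [ttau|ttau] := ltP t tau.
    rewrite mem_set/= ?in_itv/= ?ttau// mulr1 le_min ge_min lexx/=.
    by rewrite (le_trans _ (ltW ttau))// ge_min lexx orbT.
  by rewrite memNset/= ?in_itv/= ?ltNge ?ttau// mulr0 le_min ler01 ltW.
case: (sigma _) (measure_ge0 sigma `]t, +oo[%classic) => // [r _|_].
  by move=> _; rewrite ltry.
by rewrite gt0_muley ?lte_fin.
Qed.

Lemma measurable_pos : measurable pos. Proof. exact: measurable_itv. Qed.

(* [sigma] is sigma-finite only on the positive half-line; the proof argument
   lets the sigma-finite instance be inferred. *)
Definition levy_restr (_ : levy_measure sigma) := mrestr sigma measurable_pos.

HB.instance Definition _ := Measure.on (levy_restr sigma_levy).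

Let sigma_finite_levy_restr : sigma_finite setT (levy_restr sigma_levy).
Proof.
(* The nonpositive half-line is null for the restricted measure, and each tail from [1 / (n + 1)]
   has finite mass. *)
exists (fun n => `]-oo, 0]%classic `|` `]n.+1%:R^-1, +oo[%classic).
  apply/esym; rewrite -subTset => x _.
  have [x0|x0] := leP x 0.
    by exists 0%N => //; left; rewrite /= in_itv.
  have [n nx] := ltr_add_invr x0.
  by exists n => //; right; rewrite /= in_itv/= andbT; rewrite add0r in nx.
move=> n; split.
  by apply: measurableU; exact: measurable_itv.
rewrite /levy_restr /mrestr setIUl (_ : _ `&` _ = set0) ?set0U; last first.
  apply/seteqP; split => // x [] /=; rewrite !in_itv/= andbT => x0.
  by rewrite ltNge x0.
rewrite setIidl; first exact: levy_tail_lty.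
by move=> x /=; rewrite !in_itv/= !andbT; exact: lt_trans.
Qed.

HB.instance Definition _ := Measure_isSigmaFinite.Build _ _ _
  (levy_restr sigma_levy) sigma_finite_levy_restr.

(** Tonelli for [e^(- lambda s)] on the region [0 < s < tau], with [tau] under [sigma] and [s] under
    Lebesgue measure. Integrating [s] first gives [(1 - e^(- lambda tau)) / lambda]; integrating
    [tau] first gives [e^(- lambda s) * k s]. *)
Lemma laplace_exponentE (lambda : R) : 0 < lambda ->
  laplace_exponent sigma lambda =
  lambda * laplace_transform (levy_tail sigma) lambda.
Proof.
move=> lambda0.
pose A := [set p : R * R | 0 < p.2 < p.1].
pose f (p : R * R) := (expR (- (lambda * p.2)) * \1_A p)%:E.
have mA : measurable A.
  have m12 : measurable_fun setT (fun p : R * R => (0 < p.2) && (p.2 < p.1)).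
    apply: measurable_and; apply: measurable_fun_ltr.
    - exact: measurable_cst.
    - exact: measurable_snd.
    - exact: measurable_snd.
    - exact: measurable_fst.
  have := m12 measurableT [set true] Logic.I.
  by rewrite setTI.
have mf : measurable_fun setT f.
  apply/measurable_EFinP/measurable_funM; last exact: measurable_indic.
  apply: measurableT_comp => //; apply: measurable_funN.
  by apply: measurable_funM => //; exact: measurable_snd.
have f0 p : (0 <= f p)%E by rewrite lee_fin mulr_ge0 ?expR_ge0.
have levy_integralE (g : R -> \bar R) : (forall tau, tau <= 0 -> g tau = 0%E) ->
    (\int[levy_restr sigma_levy]_tau g tau = \int[sigma]_(tau in pos) g tau)%E.
  move=> g0.
  transitivity (\int[levy_restr sigma_levy]_(tau in pos) g tau)%E.
    rewrite [RHS]integral_mkcond; apply: eq_integral => tau _.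
    rewrite patchE; case: ifPn => //; rewrite notin_setE/= in_itv/= andbT.
    by move=> /negP; rewrite -leNgt => /g0.
  apply: eq_measure_integral => B mB Bpos.
  by change (sigma (B `&` pos) = sigma B); rewrite setIidl.
have fE tau s : f (tau, s) =
    ((expR (- (lambda * s)))%:E * (\1_(`]0%R, tau[%classic) s)%:E)%E.
  rewrite /f EFinM !indicE.
  suff -> : ((tau, s) \in A) = (s \in `]0%R, tau[%classic) by [].
  by apply/idP/idP; rewrite !inE.
have inner tau : 0 < tau -> (\int[lebesgue_measure]_s f (tau, s) =
    (lambda^-1 * (1 - expR (- (lambda * tau))))%:E)%E.
  (* The integrand is [lambda^-1] times the exponential density of rate [lambda], whose mass on
     [[0, tau]] is known. *)
  move=> tau0; have mexp : measurable_fun `]0, tau[%classic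
      (fun s => (lambda^-1)%:E * (exponential_pdf lambda s)%:E)%E.
    apply: measurable_funeM; apply/measurable_EFinP; apply: measurable_funTS.
    by apply: measurable_exponential_pdf.
  transitivity (\int[lebesgue_measure]_(s in `]0%R, tau[)
      ((lambda^-1)%:E * (exponential_pdf lambda s)%:E))%E.
    rewrite [RHS]integral_mkcond; apply: eq_integral => s _; rewrite fE patchE indicE.
    case: ifPn => [|_]; last by rewrite mule0.
    rewrite inE/= in_itv/= => /andP[s0 _]; rewrite mule1 -EFinM.
    by rewrite exponential_pdfE ?ltW// mulKf ?gt_eqF// mulNr.
  rewrite -(integral_itv_bndoo true false)// ge0_integralZl//=; last 3 first.
  - by apply/measurable_EFinP; apply: measurable_funTS; exact: measurable_exponential_pdf.
  - by move=> s _; rewrite lee_fin exponential_pdf_ge0// ltW.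
  - by rewrite lee_fin invr_ge0 ltW.
  have := exponential_prob_itv0c lambda tau0; rewrite /exponential_prob => ->.
  by rewrite -EFinB -EFinM mulNr.
have outer s : 0 < s -> (\int[levy_restr sigma_levy]_tau f (tau, s) =
    (expR (- (lambda * s)) * levy_tail sigma s)%:E)%E.
  move=> s0; under eq_integral => tau _.
    rewrite fE (_ : \1_(`]0%R, tau[%classic) s = \1_(`]s, +oo[%classic) tau); last first.
      rewrite !indicE.
      suff -> : (s \in `]0%R, tau[%classic) = (tau \in `]s, +oo[%classic) by [].
      by apply/idP/idP; rewrite !inE/= !in_itv/= s0 andbT.
    over.
  rewrite ge0_integralZl//=; last first.
    by apply/measurable_EFinP; exact: measurable_indic.
  rewrite integral_indic// setIT EFinM; congr (_ * _)%E.
  rewrite /levy_tail fineK ?ge0_fin_numE ?levy_tail_lty//.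
  change (sigma (`]s, +oo[%classic `&` pos) = sigma `]s, +oo[%classic).
  by rewrite setIidl// => x /=; rewrite !in_itv/= !andbT; exact: lt_trans.
have := fubini_tonelli (m1 := levy_restr sigma_levy)
  (m2 := @lebesgue_measure R) f mf f0.
rewrite levy_integralE; last first.
  move=> tau tau0; apply: integral0_eq => s _.
  rewrite fE [X in (_ * X)%E](_ : _ = 0%E) ?mule0//.
  rewrite indicE memNset//= in_itv/= => /andP[s0 /(lt_trans s0)].
  by rewrite ltNge tau0.
rewrite (eq_integral (fun tau =>
    (lambda^-1)%:E * (1 - expR (- (lambda * tau)))%:E)%E); last first.
  by move=> tau; rewrite inE/= in_itv/= andbT => /inner ->.
rewrite ge0_integralZl//=; last 3 first.
- apply/measurable_EFinP/measurable_funB => //; apply: measurableT_comp => //.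
  by apply: measurable_funN; apply: measurable_funM.
- move=> tau; rewrite in_itv/= andbT => tau0; rewrite lee_fin subr_ge0.
  by rewrite -expR0 ler_expR oppr_le0 mulr_ge0// ltW.
- by rewrite lee_fin invr_ge0 ltW.
rewrite [RHS](_ : _ =
    \int[lebesgue_measure]_(s in pos)
      (expR (- (lambda * s)) * levy_tail sigma s)%:E)%E; last first.
  rewrite [RHS]integral_mkcond; apply: eq_integral => s _.
  rewrite patchE; case: ifPn => [|]; first by rewrite inE/= in_itv/= andbT => /outer.
  rewrite notin_setE/= in_itv/= andbT => /negP; rewrite -leNgt => s0.
  apply: integral0_eq => tau _.
  rewrite fE [X in (_ * X)%E](_ : _ = 0%E) ?mule0//.
  by rewrite indicE memNset//= in_itv/= ltNge s0.
rewrite /laplace_exponent /laplace_transform /Rintegral => <-.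
set I := integral _ _ _.
(* No finiteness of the integral has to be shown: [fine] sends both infinities to [0], and the two
   sides then agree. *)
case: I => [r| |]; rewrite ?mulr0//=.
- by rewrite mulVKf// gt_eqF.
- by rewrite gt0_muley ?lte_fin ?invr_gt0//= mulr0.
- by rewrite gt0_muleNy ?lte_fin ?invr_gt0//= mulr0.
Qed.
End laplace_exponent.

(** * Integrals of a bounded profile against a law density *)

Lemma law_density_tail (d : measure_display) (T : measurableType d)
    (R : realType) (P : probability T R) (X : T -> \bar R) (g : R -> R) (a : R) :
  is_law_density P X g -> 0 <= a ->
  P (X @^-1` [set x | (a%:E <= x)%E]) =
  (\int[lebesgue_measure]_(tau in `[a, +oo[) (g tau)%:E)%E.
Proof.
move=> Xg a0; rewrite (density_law Xg); last first.
  have := emeasurable_itv (Interval (BLeft a%:E) +oo%O).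
  by congr (measurable _); apply/seteqP; split => x /=; rewrite in_itv/= andbT.
congr (integral _ _ _); apply/seteqP; split=> tau /=; rewrite in_itv/= andbT.
  by move=> [].
by move=> atau; split; [exact: le_trans atau|rewrite lee_fin].
Qed.

Section law_density.
Context (d : measure_display) (T : measurableType d) (R : realType)
  (P : probability T R) (X : T -> \bar R) (g h : R -> R).
Context (Xg : is_law_density P X g) (h01 : forall tau, 0 <= h tau <= 1).

Let tail a := (\int[lebesgue_measure]_(tau in `[a, +oo[) (g tau)%:E)%E.

Let tail0 : tail 0 = 1%E.
Proof.
rewrite /tail -(probability_setT P) -(preimage_setT X) (density_law Xg)//.
congr (integral _ _ _); apply/seteqP; split=> tau /=; rewrite in_itv/= andbT//.
by move=> [].
Qed.

Let tailE a : 0 <= a -> tail a = (\int[lebesgue_measure]_(tau in `[0%R, +oo[)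
  (\1_(`[a, +oo[%classic) tau * g tau)%:E)%E.
Proof.
move=> a0; transitivity
  (\int[lebesgue_measure]_(tau in `[0%R, +oo[ `&` `[a, +oo[) (g tau)%:E)%E.
  rewrite setIidr// => x /=; rewrite !in_itv/= !andbT; exact: le_trans.
rewrite integral_mkcondr; apply: eq_integral => tau _.
by rewrite patchE indicE; case: ifPn => _; rewrite ?mul1r ?mul0r.
Qed.

(** Since [h <= 1], pointwise [h <= eps + 1_[a, oo)]; the first term integrates to [eps] because [g]
    has mass one. *)
Lemma integral_law_density_le (a eps : R) : 0 <= a -> 0 <= eps ->
  (forall tau, 0 <= tau < a -> h tau <= eps) ->
  (\int[lebesgue_measure]_(tau in `[0%R, +oo[) (h tau * g tau)%:E <=
   eps%:E + P (X @^-1` [set x | a%:E <= x]))%E.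
Proof.
move=> a0 eps0 heps.
rewrite (law_density_tail _ _ _ _ _ _ _ Xg a0) -[eps%:E]mule1 -tail0.
have := tailE a a0; rewrite {1}/tail => ->.
rewrite -ge0_integralZl//=; last 2 first.
- apply/measurable_EFinP; exact: density_measurable Xg.
- move=> tau; rewrite in_itv/= andbT => t0; rewrite lee_fin.
  exact: density_ge0 Xg _ t0.
rewrite -ge0_integralD//=; last 4 first.
- move=> tau; rewrite in_itv/= andbT => t0; rewrite -EFinM lee_fin mulr_ge0//.
  exact: density_ge0 Xg _ t0.
- apply/measurable_EFinP/measurable_funM; first exact: measurable_cst.
  exact: density_measurable Xg.
- move=> tau; rewrite in_itv/= andbT => t0; rewrite lee_fin mulr_ge0//.
  exact: density_ge0 Xg _ t0.
- apply/measurable_EFinP/measurable_funM; last exact: density_measurable Xg.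
  exact: measurable_indic.
apply: ge0_le_integral_nonmeasurable => tau /=; rewrite in_itv/= andbT => t0.
  by have /andP[? _] := h01 tau; rewrite lee_fin mulr_ge0// (density_ge0 Xg).
have g0 := density_ge0 Xg t0; have /andP[_ h1] := h01 tau.
rewrite -EFinM -EFinD -mulrDl lee_fin ler_wpM2r// indicE.
have [taua|atau] := ltP tau a.
  rewrite memNset; first by rewrite addr0 heps// t0 taua.
  by rewrite /= in_itv/= andbT leNgt taua.
by rewrite mem_set/= ?in_itv/= ?atau// (le_trans h1)// lerDr.
Qed.

(** Pointwise, [c * 1_[b, oo) <= h]. *)
Lemma integral_law_density_ge (b c : R) : 0 <= b -> 0 <= c ->
  (forall tau, b <= tau -> c <= h tau) ->
  (c%:E * P (X @^-1` [set x | b%:E <= x]) <=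
   \int[lebesgue_measure]_(tau in `[0%R, +oo[) (h tau * g tau)%:E)%E.
Proof.
move=> b0 c0 hc.
rewrite (law_density_tail _ _ _ _ _ _ _ Xg b0).
have := tailE b b0; rewrite {1}/tail => ->.
rewrite -ge0_integralZl//=; last 2 first.
- apply/measurable_EFinP/measurable_funM; last exact: density_measurable Xg.
  exact: measurable_indic.
- move=> tau; rewrite in_itv/= andbT => t0; rewrite lee_fin mulr_ge0//.
  exact: density_ge0 Xg _ t0.
apply: ge0_le_integral_nonmeasurable => tau /=; rewrite in_itv/= andbT => t0.
  by rewrite -EFinM lee_fin !mulr_ge0// (density_ge0 Xg).
have g0 := density_ge0 Xg t0; have /andP[h0 _] := h01 tau.
rewrite -EFinM mulrA lee_fin ler_wpM2r// indicE.
have [taub|btau] := ltP tau b.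
  rewrite memNset; first by rewrite mulr0.
  by rewrite /= in_itv/= andbT leNgt taub.
by rewrite mem_set/= ?in_itv/= ?btau// mulr1 hc.
Qed.

End law_density.

(** * Bounds on the subordinated wave and on its Cesàro mean *)

Section subordinated_wave.
Context (d : measure_display) (T : measurableType d) (R : realType)
  (P : probability T R) (sigma : {measure set R -> \bar R})
  (S : R -> {RV P >-> R}) (G : R -> R -> R).
Context (S_subordinator : subordinator sigma S)
  (G_density : forall t : R, 0 < t ->
     is_law_density P (inverse_process (fun s omega => S s omega) t) (G t)).

Local Notation Phi := (laplace_exponent sigma).
Local Notation E := (inverse_process (fun s omega => S s omega)).

Lemma subordinator_nondecreasing omega s t : 0 <= s -> s <= t ->
  S s omega <= S t omega.
Proof.
by move=> s0 st; rewrite -subr_ge0; exact: (subordinator_increments_ge0 S_subordinator).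
Qed.

Lemma subordinator_ge0 omega t : 0 <= t -> 0 <= S t omega.
Proof.
move=> t0; rewrite -(subordinator_start S_subordinator omega).
exact: subordinator_nondecreasing.
Qed.

(** The event is the countable intersection of the events [S (u n) < t] along
    [u n = a - a / (n + 1)], which increases to [a]. Monotone paths suffice: any [s] with [t <= S s]
    must exceed every [u n], hence be at least [a]. *)
Lemma measurable_inverse_process_ge (t a : R) : 0 < a ->
  measurable (E t @^-1` [set x | (a%:E <= x)%E]).
Proof.
move=> a0; pose u n := a - a / n.+1%:R.
have u0 n : 0 <= u n.
  by rewrite subr_ge0 ler_pdivrMr ?ltr0n// ler_peMr ?ler1n// ltW.
have ua n : u n < a by rewrite ltrBlDr ltrDl divr_gt0.
rewrite (_ : _ @^-1` _ = \bigcap_n [set omega | S (u n) omega < t]).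
  by apply: bigcapT_measurable => n; exact: measurable_RV_lt.
apply/seteqP; split => omega.
  by move=> aE n _; exact: inverse_process_lt (ua n) aE.
move=> Su; apply/le_ereal_inf_tmp => _ [s [s0 ts] <-].
rewrite lee_fin; apply/ler_addgt0Pr => e e0.
have [n ne] := ltr_add_invr (divr_gt0 e0 a0).
rewrite add0r ltr_pdivlMr// mulrC in ne.
have us : u n <= s.
  rewrite leNgt; apply/negP => /ltW su.
  have := lt_le_trans (Su n Logic.I) ts.
  by rewrite ltNge (subordinator_nondecreasing _ _ _ s0 su).
by rewrite -lerBlDr (le_trans _ us)// lerD2l lerN2 ltW.
Qed.

Lemma inverse_process_ge_prob_ge (t a : R) : 0 < a ->
  (P [set omega | (S a omega < t)%R] <= P (E t @^-1` [set x | a%:E <= x]))%E.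
Proof.
move=> a0; apply: le_measure; rewrite ?inE.
- exact: measurable_RV_lt.
- exact: measurable_inverse_process_ge.
- move=> omega /=; apply: inverse_process_ge; rewrite ?ltW// => s r.
  exact: subordinator_nondecreasing.
Qed.

Lemma inverse_process_ge_prob_le (t a a' : R) : 0 <= a' -> a' < a ->
  (P (E t @^-1` [set x | a%:E <= x]) <= P [set omega | (S a' omega < t)%R])%E.
Proof.
move=> a'0 a'a; apply: le_measure; rewrite ?inE.
- by apply: measurable_inverse_process_ge; exact: le_lt_trans a'a.
- exact: measurable_RV_lt.
- by move=> omega; exact: inverse_process_lt a'a.
Qed.

Context (u : R -> R -> R).

Context (u01 : forall x t, 0 <= u x t <= 1).

(** The wave is at most [eps] while [E s < a]; the remaining event lies in [S a' < s], whose
    probability the upper Chernoff bound controls. *)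
Lemma subordination_le (x s a a' eps lambda : R) : 0 < s -> 0 <= lambda ->
  0 <= a' -> a' < a -> 0 <= eps ->
  (forall tau, 0 <= tau < a -> u x tau <= eps) ->
  0 <= subordination G u x s <= eps + expR (lambda * s - a' * Phi lambda).
Proof.
move=> s0 lambda0 a'0 a'a eps0 ueps.
have Gs := G_density s s0.
rewrite /subordination /Rintegral.
set I := integral _ _ _.
have I0 : (0 <= I)%E.
  apply: integral_ge0 => tau /=; rewrite in_itv/= andbT => tau0.
  by rewrite lee_fin mulr_ge0 ?(density_ge0 Gs)//; have /andP[] := u01 x tau.
have Ile : (I <= (eps + expR (lambda * s - a' * Phi lambda))%:E)%E.
  apply: le_trans
    (integral_law_density_le _ _ _ _ _ _ _ Gs (u01 x) a eps _ eps0 ueps) _.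
    exact: le_trans a'0 (ltW a'a).
  rewrite EFinD leeD2l//.
  apply: le_trans (inverse_process_ge_prob_le _ _ _ a'0 a'a) _.
  rewrite expRD.
  by apply: laplace_tail_le => //; exact: (subordinator_laplace S_subordinator).
have Ifin : I \is a fin_num by rewrite ge0_fin_numE// (le_lt_trans Ile) ?ltry.
by rewrite fine_ge0//= -lee_fin fineK.
Qed.

Lemma subordination_ge (x s b c lambda : R) : 0 < s -> 0 <= lambda ->
  0 < b -> 0 <= c -> (forall tau, b <= tau -> c <= u x tau) ->
  c * (expR (- (b * Phi lambda)) - expR (- (lambda * s))) <=
    subordination G u x s.
Proof.
move=> s0 lambda0 b0 c0 cu.
have Gs := G_density s s0.
rewrite /subordination /Rintegral.
set I := integral _ _ _.
have I0 : (0 <= I)%E.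
  apply: integral_ge0 => tau /=; rewrite in_itv/= andbT => tau0.
  by rewrite lee_fin mulr_ge0 ?(density_ge0 Gs)//; have /andP[] := u01 x tau.
(* The upper estimate with [a = eps = 1] bounds the integral by [2], so [fine] loses nothing. *)
have Ifin : I \is a fin_num.
  rewrite ge0_fin_numE//; apply: (le_lt_trans (y := (1%:E + 1%:E)%E)); last first.
    by rewrite -EFinD ltry.
  apply: le_trans
    (integral_law_density_le _ _ _ _ _ _ _ Gs (u01 x) 1 1 _ _ _) _ => //.
    by move=> tau _; have /andP[] := u01 x tau.
  rewrite leeD2l// probability_le1//.
  exact: measurable_inverse_process_ge.
rewrite -lee_fin fineK//.
apply: le_trans
  (integral_law_density_ge _ _ _ _ _ _ _ Gs (u01 x) b c (ltW b0) c0 cu).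
rewrite EFinM lee_wpmul2l ?lee_fin//.
apply: le_trans (inverse_process_ge_prob_ge _ _ b0).
apply: laplace_tail_ge => //.
  by apply: (subordinator_laplace S_subordinator) => //; rewrite ltW.
by move=> omega; apply: subordinator_ge0; rewrite ltW.
Qed.

Lemma cesaro_subordination_le (x t a a' eps lambda : R) : 0 < t ->
  0 <= lambda -> 0 <= a' -> a' < a -> 0 <= eps ->
  (forall tau, 0 <= tau < a -> u x tau <= eps) ->
  cesaro_mean (subordination G u x) t <=
    eps + expR (lambda * t - a' * Phi lambda).
Proof.
move=> t0 lambda0 a'0 a'a eps0 ueps; apply: cesaro_mean_le => // s /andP[s0 st].
have /andP[-> /=] := subordination_le x s a a' _ _ s0 lambda0 a'0 a'a eps0 ueps.
move=> /le_trans; apply.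
by rewrite lerD2l ler_expR lerD2r ler_wpM2l.
Qed.

(** The pointwise lower bound increases with [s], so on [[delta * t, t]] its value at [delta * t] is
    the worst one. *)
Lemma cesaro_subordination_ge (x t b c delta lambda : R) : 0 < t ->
  0 <= lambda -> 0 < b -> 0 <= c -> 0 <= delta <= 1 ->
  0 <= expR (- (b * Phi lambda)) - expR (- (lambda * (delta * t))) ->
  (forall tau, b <= tau -> c <= u x tau) ->
  c * (expR (- (b * Phi lambda)) - expR (- (lambda * (delta * t)))) * (1 - delta)
    <= cesaro_mean (subordination G u x) t.
Proof.
move=> t0 lambda0 b0 c0 d01 B0 cu.
(* The crude bound [2] is [subordination_le] with [eps = 1] and [lambda = 0]. *)
apply: (cesaro_mean_ge _ _ _ 2) => //; last 2 first.
- exact: mulr_ge0.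
- move=> s /andP[ds _] s0.
  apply: le_trans (subordination_ge x s b c _ s0 lambda0 b0 c0 cu).
  by rewrite ler_wpM2l// lerD2l lerN2 ler_expR lerN2 ler_wpM2l.
move=> s /andP[s0 _].
have := subordination_le x s 1 0 1 0 s0 (lexx _) (lexx _) ltr01 ler01.
rewrite !mul0r subr0 expR0; apply => tau _.
by have /andP[] := u01 x tau.
Qed.

End subordinated_wave.

(** * Asymptotics of the Laplace exponent at [L / t] *)

Lemma cvg_lny (R : realType) : @ln R t @[t --> +oo] --> +oo.
Proof.
apply/cvgryPgt => A; near=> t.
have At : expR A < t by near: t; exact: (nbhs_pinfty_gt (num_real _)).
by rewrite -[A]expRK ltr_ln ?posrE ?expR_gt0// (lt_trans _ At) ?expR_gt0.
Unshelve. all: by end_near. Qed.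

(** With [lambda = L / t], [lambda * K lambda] is equivalent to [mu0 / ln (t / L)]. The limit does
    not depend on [L], because [ln] is slowly varying; this leaves [L] free for tuning the Chernoff
    bounds. *)
Lemma laplace_exponent_asymp (R : realType)
    (sigma : {measure set R -> \bar R}) (mu0 L : R) :
  levy_measure sigma -> 0 < mu0 -> 0 < L ->
  asymp_equiv 0^'+ (laplace_transform (levy_tail sigma))
    (fun lambda => lambda^-1 * mu0 * (ln (lambda^-1))^-1) ->
  laplace_exponent sigma (L / t) * ln t @[t --> +oo] --> mu0.
Proof.
move=> sigma_levy mu0_gt0 L0 Kasymp.
have Lt : L / t @[t --> +oo] --> 0^'+.
  move=> U [e /= e0 eU]; change (\forall t \near +oo, U (L / t)); near=> t.
  have t0 : 0 < t by near: t; exact: (nbhs_pinfty_gt (num_real _)).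
  have et : L / e < t by near: t; exact: (nbhs_pinfty_gt (num_real _)).
  apply: eU; last by rewrite divr_gt0.
  rewrite /= sub0r normrN gtr0_norm ?divr_gt0//.
  by rewrite ltr_pdivrMr// mulrC -ltr_pdivrMr.
(* This is the ratio [ln t / ln (t / L)]. *)
have lnq : (1 - ln L / ln t)^-1 @[t --> +oo] --> (1 : R).
  rewrite -[X in _ --> X]invr1; apply: cvgV => //.
  rewrite -[X in _ --> X]subr0; apply: cvgB; first exact: cvg_cst.
  rewrite -[X in _ --> X](mulr0 (ln L)); apply: cvgMl_tmp.
  apply/gtr0_cvgV0; last exact: cvg_lny.
  by near=> t; rewrite ln_gt0//; near: t; exact: (nbhs_pinfty_gt (num_real _)).
have := cvgM (cvgM (cvg_comp _ _ Lt Kasymp) (cvg_cst mu0)) lnq.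
rewrite !mul1r mulr1 => /(_ _ _ _) h.
apply: cvg_trans h; apply: near_eq_cvg.
near=> t.
have t1 : 1 < t by near: t; exact: (nbhs_pinfty_gt (num_real _)).
have tL : L < t by near: t; exact: (nbhs_pinfty_gt (num_real _)).
have t0 : 0 < t by exact: lt_trans t1.
have lnt0 : 0 < ln t by rewrite ln_gt0.
rewrite /= laplace_exponentE ?divr_gt0//.
have ltL : 0 < ln t - ln L by rewrite subr_gt0 ltr_ln ?posrE.
have -> : ln (L / t)^-1 = ln t - ln L.
  by rewrite invf_div lnM ?posrE ?invr_gt0// lnV ?posrE.
have -> : 1 - ln L / ln t = (ln t - ln L) / ln t.
  by rewrite mulrBl divff// gt_eqF.
set K := laplace_transform _ _.
by field; rewrite ?gt_eqF.
Unshelve. all: by end_near. Qed.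

(** * Location of the front *)

Section front.
Context (d : measure_display) (T : measurableType d) (R : realType)
  (P : probability T R) (v : R) (psi : R -> R)
  (sigma : {measure set R -> \bar R}) (S : R -> {RV P >-> R})
  (G : R -> R -> R) (mu0 beta : R) (x : R -> R).
Context (v_gt0 : 0 < v)
  (psi01 : forall y : R, 0 <= psi y <= 1)
  (psi_ninfty : psi y @[y --> -oo] --> (1 : R))
  (psi_pinfty : psi y @[y --> +oo] --> (0 : R))
  (S_subordinator : subordinator sigma S)
  (G_density : forall t : R, 0 < t ->
    is_law_density P (inverse_process (fun s omega => S s omega) t) (G t))
  (mu0_gt0 : 0 < mu0)
  (Phi_asymp : forall L, 0 < L ->
    laplace_exponent sigma (L / t) * ln t @[t --> +oo] --> mu0)
  (beta_gt0 : 0 < beta) (beta_lt1 : beta < 1)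
  (x_level : forall t, 0 < t ->
    cesaro_mean (subordination G (traveling_wave psi v) (x t)) t = beta).

(** The solution [y] of [e^(- y mu0 / v) = beta]. *)
Local Notation C := (v * ln beta^-1 / mu0).

Let wave01 y t : 0 <= traveling_wave psi v y t <= 1.
Proof. exact: psi01. Qed.

Let exp_cvg (z L : R) : 0 < L ->
  expR (- (z / v * ln t * laplace_exponent sigma (L / t))) @[t --> +oo]
    --> expR (- (z / v * mu0)).
Proof.
move=> L0; apply: continuous_cvg; first exact: continuous_expR.
apply: cvgN; under eq_fun do rewrite -mulrA [ln _ * _]mulrC.
apply: cvgMl_tmp; exact: Phi_asymp.
Qed.

Let expC : expR (- (C / v * mu0)) = beta.
Proof.
have -> : C / v * mu0 = ln beta^-1 by field; rewrite !gt_eqF.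
by rewrite lnV ?posrE// opprK lnK ?posrE.
Qed.

(** By contradiction: if [x t > y ln t], the Cesàro mean at [x t] is below [beta] for large [t],
    against the choice of [x t]. *)
Lemma front_le (y : R) : C < y -> \forall t \near +oo, x t <= y * ln t.
Proof.
move=> Cy.
have C0 : 0 < C by rewrite divr_gt0// mulr_gt0// ln_gt0 ?invf_gt1.
(* Three gaps in [C < w < z < y]: [y - z] sends [x t - v tau] to infinity for [tau < (z / v) ln t],
   [z - w] is the loss [a' < a] in inverting [S], and [w - C] pays for the Chernoff factor
   [e^delta]. *)
pose z := (C + y) / 2; pose w := (C + z) / 2.
have Cw : C < w by rewrite /w /z; lra.
have wz : w < z by rewrite /w /z; lra.
have zy : z < y by rewrite /z; lra.
(* Half of the gain [(w - C) * mu0 / v] in the exponent, so that [q = beta * e^(- delta)]. With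
   [lambda = delta / t] the Chernoff factor [e^(lambda t)] is [e^delta]. *)
pose delta := (w - C) * mu0 / (2 * v).
have delta0 : 0 < delta by rewrite divr_gt0 ?mulr_gt0 ?subr_gt0.
have qbeta : expR delta * expR (- (w / v * mu0)) < beta.
  rewrite -expC -expRD ltr_expR.
  have -> : delta - w / v * mu0 = - (C / v * mu0) - delta.
    rewrite /delta; field; by rewrite !gt_eqF.
  by rewrite ltrBlDr ltrDl.
set q := _ * _ in qbeta.
pose eps := (beta - q) / 2.
have eps0 : 0 < eps by rewrite /eps; lra.
have cvgq : expR delta * expR (- (w / v * ln t * laplace_exponent sigma (delta / t)))
    @[t --> +oo] --> q.
  by apply: cvgMl_tmp; exact: exp_cvg.
have [M [_ psiM]] : \forall y \near +oo, psi y < eps.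
  by have := psi_pinfty; move/cvgr_lt; apply.
near=> t.
have t1 : 1 < t by near: t; exact: (nbhs_pinfty_gt (num_real _)).
have t0 : 0 < t by exact: lt_trans t1.
have lnt0 : 0 < ln t by rewrite ln_gt0.
have Mt : M < (y - z) * ln t.
  rewrite mulrC -ltr_pdivrMr ?subr_gt0//.
  by near: t; move/cvgryPgt : (cvg_lny R); apply.
have qt : expR delta * expR (- (w / v * ln t * laplace_exponent sigma (delta / t)))
    < beta - eps.
  by near: t; move/cvgr_lt : cvgq; apply; rewrite /eps; lra.
rewrite leNgt; apply/negP => yx.
have := cesaro_subordination_le _ _ _ _ _ _ _ S_subordinator G_density _ wave01
  (x t) t (z / v * ln t) (w / v * ln t) eps (delta / t) t0.
rewrite x_level// divfK ?gt_eqF// expRD.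
suff : ~ beta <= eps +
    expR delta * expR (- (w / v * ln t * laplace_exponent sigma (delta / t))).
  move=> h1 h2; apply: h1; apply: h2.
  - by rewrite divr_ge0 ?ltW.
  - by rewrite ltW// mulr_gt0// divr_gt0// (lt_trans C0 Cw).
  - by rewrite ltr_pM2r// ltr_pM2r ?invr_gt0.
  - exact: ltW.
  - move=> tau /andP[_]; rewrite mulrAC ltr_pdivlMr// => tauz.
    apply/ltW/psiM; apply: lt_trans Mt _.
    rewrite mulrBl; lra.
by apply/negP; rewrite -ltNge; lra.
Unshelve. all: by end_near. Qed.

(** The mirror argument: if [x t < y ln t], the Cesàro mean at [x t] exceeds [beta] for large [t].
    Positivity of [y] makes the threshold [(z / v) ln t] a positive time. *)
Lemma front_ge (y : R) : 0 < y -> y < C -> \forall t \near +oo, y * ln t <= x t.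
Proof.
(* One intermediate point is enough, as the lower bound involves no loss [a' < a]: [z - y] sends
   [x t - v tau] to minus infinity for [tau >= (z / v) ln t], and [z < C] gives [q > beta]. *)
move=> y0 yC; pose z := (y + C) / 2.
have yz : y < z by rewrite /z; lra.
have zC : z < C by rewrite /z; lra.
have z0 : 0 < z by lra.
pose q := expR (- (z / v * mu0)).
have q0 : 0 < q by exact: expR_gt0.
have qbeta : beta < q.
  by rewrite -expC ltr_expR ltrN2 ltr_pM2r// ltr_pM2r ?invr_gt0.
have q1 : q < 1.
  by rewrite -expR0 ltr_expR oppr_lt0 mulr_gt0// divr_gt0.
(* The same [delta] bounds three relative losses: the wave height [1 - delta], the discarded initial
   times, and the Chernoff error [delta * q]. Together they leave [q * (1 - delta)^3], a loss of
   about [3 * delta * q], within the margin [q - beta = 4 * delta * q]. *)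
pose delta := (q - beta) / (4 * q).
have delta0 : 0 < delta by rewrite divr_gt0 ?mulr_gt0 ?subr_gt0.
have deltaq : 4 * (delta * q) = q - beta by rewrite /delta; field; rewrite gt_eqF.
have delta1 : delta < 1.
  rewrite ltr_pdivrMr ?mulr_gt0//.
  by move: beta_gt0 q0; lra.
have dq0 : 0 < delta * q by rewrite mulr_gt0.
(* Chosen so that, with [lambda = K / t], the error [e^(- lambda s)] at the earliest retained time
   [s = delta * t] is exactly [delta * q]. *)
pose K := - ln (delta * q) / delta.
have K0 : 0 < K.
  by rewrite divr_gt0// oppr_gt0 ln_lt0// dq0/= mulr_ilt1 ?ltW.
have expK : expR (- (K * delta)) = delta * q.
  by rewrite divfK ?gt_eqF// opprK lnK// posrE.
have limit : beta < (1 - delta) * (q - delta * q) * (1 - delta).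
  have -> : (1 - delta) * (q - delta * q) * (1 - delta) =
    beta + delta * q * (1 + 3 * delta - delta ^+ 2).
    rewrite [RHS](_ : _ = (q - 4 * (delta * q)) +
        delta * q * (1 + 3 * delta - delta ^+ 2)); first by ring.
    by rewrite deltaq; ring.
  rewrite ltrDl mulr_gt0//.
  have : delta ^+ 2 < 1 by rewrite expr2 mulr_ilt1// ltW.
  lra.
have cvgq := exp_cvg z K K0.
have cvgl : (1 - delta) *
    (expR (- (z / v * ln t * laplace_exponent sigma (K / t))) - delta * q) *
    (1 - delta) @[t --> +oo] --> (1 - delta) * (q - delta * q) * (1 - delta).
  apply: cvgMr_tmp; apply: cvgMl_tmp; apply: cvgB => //; exact: cvg_cst.
have [M [_ psiM]] : \forall y \near -oo, 1 - delta < psi y.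
  by have := psi_ninfty; move/cvgr_gt; apply; rewrite ltrBlDr ltrDl.
near=> t.
have t1 : 1 < t by near: t; exact: (nbhs_pinfty_gt (num_real _)).
have t0 : 0 < t by exact: lt_trans t1.
have lnt0 : 0 < ln t by rewrite ln_gt0.
have Mt : - M < (z - y) * ln t.
  rewrite mulrC -ltr_pdivrMr ?subr_gt0//.
  by near: t; move/cvgryPgt : (cvg_lny R); apply.
have lt : beta < (1 - delta) *
    (expR (- (z / v * ln t * laplace_exponent sigma (K / t))) - delta * q) *
    (1 - delta).
  by near: t; move/cvgr_gt : cvgl; apply.
have qt : delta * q < expR (- (z / v * ln t * laplace_exponent sigma (K / t))).
  near: t; move/cvgr_gt : cvgq; apply.
  by rewrite -/q gtr_pMl.
rewrite leNgt; apply/negP => xy.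
have := cesaro_subordination_ge _ _ _ _ _ _ _ S_subordinator G_density _ wave01
  (x t) t (z / v * ln t) (1 - delta) delta (K / t) t0.
rewrite x_level//.
have -> : K / t * (delta * t) = K * delta by field; rewrite gt_eqF.
rewrite expK => h; suff /(lt_le_trans lt) : (1 - delta) *
    (expR (- (z / v * ln t * laplace_exponent sigma (K / t))) - delta * q) *
    (1 - delta) <= beta by rewrite ltxx.
apply: h.
- by rewrite divr_ge0 ?ltW.
- exact: (mulr_gt0 (divr_gt0 z0 v_gt0) lnt0).
- by rewrite subr_ge0 ltW.
- by rewrite (ltW delta0) (ltW delta1).
- by rewrite subr_ge0 ltW.
- move=> tau; rewrite mulrAC ler_pdivrMr// => tauz.
  apply/ltW/psiM.
  rewrite mulrBl in Mt; lra.
Unshelve. all: by end_near. Qed.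

Lemma front_cvg : x t / ln t @[t --> +oo] --> C.
Proof.
have C0 : 0 < C by rewrite divr_gt0// mulr_gt0// ln_gt0 ?invf_gt1.
apply/cvgrPdist_le => e e0.
near=> t.
have t1 : 1 < t by near: t; exact: (nbhs_pinfty_gt (num_real _)).
have lnt0 : 0 < ln t by rewrite ln_gt0.
have up : x t <= (C + e) * ln t.
  by near: t; apply: front_le; rewrite ltrDl.
(* The maximum with [C / 2] keeps the slope positive, as [front_ge] requires, even when [e >= C]. *)
have lo : Num.max (C / 2) (C - e) * ln t <= x t.
  near: t; apply: front_ge.
    by rewrite lt_max divr_gt0.
  by rewrite gt_max; apply/andP; split; lra.
rewrite ler_distlC; apply/andP; split.
  rewrite ler_pdivlMr//; apply: le_trans lo.
  by rewrite ler_pM2r// le_max lexx orbT.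
by rewrite ler_pdivrMr.
Unshelve. all: by end_near. Qed.

End front.

(** * Two-sided logarithmic bounds and the exact asymptotics *)

Theorem theorem11 (R : realType) (d : measure_display) (T : measurableType d)
    (P : probability T R) (v : R) (psi : R -> R) (xm xp : R -> R)
    (sigma : {measure set R -> \bar R}) (S : R -> {RV P >-> R})
    (G : R -> R -> R) (mu0 : R) (xfront : R -> R -> R)
    (v_gt0 : 0 < v)
    (psi_range : forall y : R, 0 <= psi y /\ psi y <= 1)
    (psi_continuous : continuous psi)
    (psi_decreasing : forall y z : R, y <= z -> psi z <= psi y)
    (psi_ninfty : psi y @[y --> -oo] --> (1 : R))
    (psi_pinfty : psi y @[y --> +oo] --> (0 : R))
    (xp_choice : forall eps y : R, 0 < eps -> xp eps < y -> psi y < eps)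
    (xm_choice : forall eps y : R, 0 < eps -> y < xm eps -> 1 - eps < psi y)
    (two_sided : forall x t eps : R, 0 <= t -> 0 < eps ->
      lower_wave v xm eps x t <= traveling_wave psi v x t /\
      traveling_wave psi v x t <= upper_wave v xp eps x t)
    (sigma_levy : levy_measure sigma)
    (S_subordinator : subordinator sigma S)
    (G_density : forall t : R, 0 < t ->
      is_law_density P (inverse_process (fun s omega => S s omega) t) (G t))
    (mu0_gt0 : 0 < mu0)
    (K_asymp : asymp_equiv 0^'+ (laplace_transform (levy_tail sigma))
      (fun lambda => lambda^-1 * mu0 * (ln (lambda^-1))^-1))
    (xfront_level : forall beta t : R, 0 < beta -> beta < 1 -> 0 < t ->
      cesaro_mean (subordination G (traveling_wave psi v) (xfront beta t)) t
      = beta) :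
  forall beta : R, 0 < beta -> beta < 1 ->
    (exists Cm Cp : R, [/\ 0 < Cm, 0 < Cp &
       \forall t \near +oo,
         Cm * ln t <= xfront beta t /\ xfront beta t <= Cp * ln t]) /\
    (exists C : R, 0 < C /\
       asymp_equiv +oo (xfront beta) (fun t => C * ln t)).
Proof.
move=> beta beta0 beta1; set C := v * ln beta^-1 / mu0.
have C0 : 0 < C by rewrite divr_gt0// mulr_gt0// ln_gt0 ?invf_gt1.
have psi01 y : 0 <= psi y <= 1 by apply/andP; exact: psi_range.
have Phi_asymp L : 0 < L ->
    laplace_exponent sigma (L / t) * ln t @[t --> +oo] --> mu0.
  by move=> L0; exact: laplace_exponent_asymp.
have level t : 0 < t ->
    cesaro_mean (subordination G (traveling_wave psi v) (xfront beta t)) t = beta.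
  exact: xfront_level.
have front_le := front_le _ _ _ _ _ _ _ _ _ _ _ _ v_gt0 psi01 psi_pinfty
  S_subordinator G_density mu0_gt0 Phi_asymp beta0 beta1 level.
have front_ge := front_ge _ _ _ _ _ _ _ _ _ _ _ _ v_gt0 psi01 psi_ninfty
  S_subordinator G_density mu0_gt0 Phi_asymp beta0 level.
have xC := front_cvg _ _ _ _ _ _ _ _ _ _ _ _ v_gt0 psi01 psi_ninfty psi_pinfty
  S_subordinator G_density mu0_gt0 Phi_asymp beta0 beta1 level.
split.
  exists (C / 2), (2 * C); split; [by rewrite divr_gt0|by rewrite mulr_gt0|].
  near=> t; split; near: t.
    by apply: front_ge; [rewrite divr_gt0|rewrite -/C; lra].
  by apply: front_le; rewrite -/C; lra.
exists C; split => //; rewrite /asymp_equiv.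
have CC : C / C = 1 by rewrite divff// gt_eqF.
rewrite -CC (_ : (fun t => _) = (fun t => xfront beta t / ln t / C)); last first.
  by apply/funext => t; rewrite invfM mulrA mulrAC.
exact: cvgMr_tmp.
Unshelve. all: by end_near. Qed.
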